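(* For $\mu>0$, the quantities $\Lambda_{\tilde N}$, $\Lambda_N$, $\Lambda_R$ and $\Lambda_D$ defined in the context are positive and bounded below independently of $\mu$; that is, there is a constant $c>0$, not depending on $\mu$, such that $\Lambda_{\tilde N},\Lambda_N,\Lambda_R,\Lambda_D\geq c$ for every $\mu>0$.
   Context: Let $s\in(0,1)$, let $\Omega\subset\mathbb{R}^n$ be a bounded open set with $C^{0,1}$ boundary, $\Omega^c=\mathbb{R}^n\setminus\Omega$, and let $\beta\in L^\infty(\mathbb{R}^n\setminus\Omega)$ be strictly positive. $G\colon[0,\infty)\to[0,\infty)$ is a Young function: $G(t)=\int_0^t g(\tau)\,d\tau$, with $g$ right continuous and nondecreasing, $g(0)=0$, $g(t)>0$ for $t>0$, $\lim_{t\to\infty}g(t)=\infty$, and $g=G'$. It satisfies: $1<p^-\leq \frac{tg(t)}{G(t)}\leq p^+<\infty$ for all $t>0$, for fixed constants $p^\pm$; $t\mapsto G(\sqrt t)$ is convex on $[0,\infty)$; $\int_0^1 \frac{G^{-1}(\tau)}{\tau^{(n+s)/n}}d\tau<\infty$ and $\int_1^\infty \frac{G^{-1}(\tau)}{\tau^{(n+s)/n}}d\tau=\infty$. Notation: $D_su(x,y)=\frac{u(x)-u(y)}{|x-y|^s}$, $d\mu=\frac{dx\,dy}{|x-y|^n}$ (unrelated to the number $\mu$). Modulars: $\Phi_{G,\Omega}(u)=\int_\Omega G(|u|)\,dx$, $\Phi_{s,G,\mathbb{R}^n}(u)=\iint_{\mathbb{R}^n\times\mathbb{R}^n}G(|D_su|)\,d\mu$,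 $\Phi_{s,G,\Omega}(u)=\iint_{\Omega\times\Omega}G(|D_su|)\,d\mu$, $\Phi_{s,G,*}(u)=\iint_{\mathbb{R}^{2n}\setminus(\Omega^c)^2}G(|D_su|)\,d\mu$, $\Phi_{G,\beta,\Omega^c}(u)=\int_{\mathbb{R}^n\setminus\Omega}\beta\,G(|u|)\,dx$. Spaces (of measurable functions): $W^{s,G}_0(\Omega)=\{u\colon\mathbb{R}^n\to\mathbb{R}: \int_{\mathbb{R}^n}G(|u|)\,dx<\infty,\ \Phi_{s,G,\mathbb{R}^n}(u)<\infty,\ u=0 \text{ a.e. in }\mathbb{R}^n\setminus\Omega\}$; $W^{s,G}_*(\Omega)=\{u\colon\mathbb{R}^n\to\mathbb{R}: \Phi_{G,\Omega}(u)<\infty,\ \Phi_{s,G,*}(u)<\infty\}$; $W^{s,G}_{reg}(\Omega)=\{u\colon\Omega\to\mathbb{R}: \Phi_{G,\Omega}(u)<\infty,\ \Phi_{s,G,\Omega}(u)<\infty\}$; $\mathcal{X}=\{u\in W^{s,G}_*(\Omega): \Phi_{G,\beta,\Omega^c}(u)<\infty\}$. For $\mu>0$: $\Lambda_D=\inf\left\{\frac{\Phi_{s,G,\mathbb{R}^n}(u)+\Phi_{G,\Omega}(u)}{\Phi_{G,\Omega}(u)}: u\in W^{s,G}_0(\Omega),\ \Phi_{G,\Omega}(u)=\mu\right\}$, $\Lambda_N=\inf\left\{\frac{\Phi_{s,G,*}(u)+\Phi_{G,\Omega}(u)}{\Phi_{G,\Omega}(u)}: u\in W^{s,G}_*(\Omega),\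 \Phi_{G,\Omega}(u)=\mu\right\}$, $\Lambda_{\tilde N}=\inf\left\{\frac{\Phi_{s,G,\Omega}(u)+\Phi_{G,\Omega}(u)}{\Phi_{G,\Omega}(u)}: u\in W^{s,G}_{reg}(\Omega),\ \Phi_{G,\Omega}(u)=\mu\right\}$, $\Lambda_R=\inf\left\{\frac{\Phi_{s,G,*}(u)+\Phi_{G,\Omega}(u)+\Phi_{G,\beta,\Omega^c}(u)}{\Phi_{G,\Omega}(u)}: u\in\mathcal{X},\ \Phi_{G,\Omega}(u)=\mu\right\}$. *)

(* Defs.v *)
From HB Require Import structures.
From mathcomp Require Import all_boot all_order all_algebra.
From mathcomp Require Import all_classical all_reals all_analysis.

Set Implicit Arguments.
Unset Strict Implicit.
Unset Printing Implicit Defensive.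

Import Order.TTheory GRing.Theory Num.Theory.
Import numFieldNormedType.Exports.

Local Open Scope classical_set_scope.
Local Open Scope ring_scope.

(** * Lebesgue measure on R^n

    The library has Lebesgue measure on the line only.  On ['rV[R]_n] we take
    the outer measure given by countable covers by half-open boxes and restrict
    it to its Caratheodory sigma-algebra, so "measurable" below means
    Lebesgue measurable. *)

Section lebesgue_outer_measure.
Context (R : realType) (n : nat).
Implicit Types (B : option ('rV[R]_n * 'rV[R]_n)) (A : set 'rV[R]_n).

(* [Some (a, b)] stands for the product of the intervals ]a_i, b_i], and [None]
   for the empty set; without [None] covers could not be finite, which matters
   in dimension 0, where the only box is the whole space, of volume 1. *)
Definition box B : set 'rV[R]_n :=
  if B is Some (a, b)
  then [set x | forall i, a ord0 i < x ord0 i <= b ord0 i] else set0.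

Definition box_volume B : R :=
  if B is Some (a, b)
  then \prod_(i < n) Num.max 0 (b ord0 i - a ord0 i) else 0.

Definition lebesgue_outer A : \bar R :=
  ereal_inf [set (\sum_(0 <= k <oo) (box_volume (B k))%:E)%E |
    B in [set B : nat -> option ('rV[R]_n * 'rV[R]_n) |
          A `<=` \bigcup_k box (B k)]].

Lemma box_volume_ge0 B : (0 <= (box_volume B)%:E)%E.
Proof.
rewrite lee_fin; case: B => [[a b]|] //=.
by apply: prodr_ge0 => i _; rewrite le_max lexx.
Qed.

Let lebesgue_outer_ge0 A : (0 <= lebesgue_outer A)%E.
Proof.
apply: le_ereal_inf_tmp => _ [B _ <-].
by apply: nneseries_ge0 => k _ _; exact: box_volume_ge0.
Qed.

Let lebesgue_outer0 : lebesgue_outer set0 = 0%E.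
Proof.
apply/eqP; rewrite eq_le lebesgue_outer_ge0 andbT.
apply: ereal_inf_lbound; exists (fun=> None) => //=.
by rewrite eseries0.
Qed.

Let le_lebesgue_outer : {homo lebesgue_outer : A B / A `<=` B >-> (A <= B)%E}.
Proof.
move=> A A' AA'; apply: ereal_inf_le_tmp => _ [B A'B <-].
by exists B => //; exact: subset_trans AA' A'B.
Qed.

Let lebesgue_outer_sigma_subadditive : sigma_subadditive lebesgue_outer.
Proof.
move=> A; have [[i ioo]|] := pselect (exists i, lebesgue_outer (A i) = +oo%E).
  rewrite (eseries_pinfty _ _ ioo) ?leey// => k _.
  by rewrite -ltNye (lt_le_trans _ (lebesgue_outer_ge0 _)).
rewrite -forallNE => Aoo.
suff add2e (e : {posnum R}) : (lebesgue_outer (\bigcup_n A n) <=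
    \sum_(i <oo) lebesgue_outer (A i) + e%:num%:E)%E.
  by apply/lee_addgt0Pr => _/posnumP[].
rewrite (le_trans _ (epsilon_trick _ _ _))//.
pose P k (B : nat -> option ('rV[R]_n * 'rV[R]_n)) :=
  A k `<=` \bigcup_j box (B j) /\
  (\sum_(j <oo) (box_volume (B j))%:E <=
    lebesgue_outer (A k) + (e%:num / (2 ^ k.+1)%:R)%:E)%E.
have [G PG] : {G & forall k, P k (G k)}.
  apply: (@choice _ _ P) => k; rewrite /P /lebesgue_outer.
  set S := (X in ereal_inf X); move infS : (ereal_inf S) => iS.
  case: iS infS => [r Sr|Soo|Soo].
  - have en1 : (0 < e%:num / (2 ^ k.+1)%:R)%R by [].
    have /(lb_ereal_inf_adherent en1) : ereal_inf S \is a fin_num by rewrite Sr.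
    move=> [x [B AB muBx] xS].
    by exists B; split => //; rewrite muBx -Sr; exact/ltW.
  - by have := Aoo k; rewrite /lebesgue_outer Soo.
  - by have := lebesgue_outer_ge0 (A k); rewrite /lebesgue_outer -/S Soo.
pose v (p : nat * nat) : \bar R := (box_volume (G p.1 p.2))%:E.
have v_ge0 p : (0 <= v p)%E by exact: box_volume_ge0.
apply: (@le_trans _ _ (\esum_(i in setT) v i)%E).
  apply: ereal_inf_lbound => /=.
  have /card_esym/ppcard_eqP[f] := card_nat2.
  exists (fun k => G (f k).1 (f k).2) => /=.
    move=> t [i _] /((PG i).1 t)[j _ Bijt].
    by exists (f^-1%FUN (i, j)) => //=; rewrite invK ?inE.
  rewrite -(esum_pred_image v f xpredT) ?[fun=> _]set_true//.
  by rewrite image_eq.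
rewrite (_ : esum _ _ = \sum_(i <oo) \sum_(j <oo ) v (i, j))%E; last first.
  pose J : nat -> set (nat * nat) := fun i => [set (i, j) | j in setT].
  rewrite (_ : setT = \bigcup_k J k); last first.
    by rewrite predeqE => -[a b]; split => // _; exists a => //; exists b.
  rewrite esum_bigcupT /=; last 2 first.
    - apply/trivIsetP => i j _ _ ij.
      rewrite predeqE => -[m p] /=; split => //= -[] [_] _ [<-{m} _].
      by move=> [m' _] [] /esym/eqP; rewrite (negbTE ij).
    - by [].
  rewrite -(image_id [set: nat]) -fun_true esum_pred_image//; last first.
    by move=> m _; exact: esum_ge0.
  apply: eq_eseriesr => /= j _.
  rewrite -(esum_pred_image v (pair j) predT)//=; last first.
    by move=> ? ? _ _; exact: (@can_inj _ _ _ snd).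
  by congr esum; rewrite predeqE => -[a b]; split; move=> [i _ <-]; exists i.
apply: lee_lim.
- apply: is_cvg_nneseries => m *.
  by apply: nneseries_ge0 => p *; exact: (v_ge0 (m, p)).
- by apply: is_cvg_nneseries => m *; apply: adde_ge0.
- by near=> m; apply: lee_sum => i _; exact: (PG i).2.
Unshelve. all: by end_near. Qed.

HB.instance Definition _ := isOuterMeasure.Build R 'rV[R]_n lebesgue_outer
  lebesgue_outer0 lebesgue_outer_ge0 le_lebesgue_outer
  lebesgue_outer_sigma_subadditive.

End lebesgue_outer_measure.

(* R^n with the sigma-algebra of Lebesgue measurable sets. *)
Notation Rn R n := (caratheodory_type (@lebesgue_outer R n)).

Section lebesgue_n.
Context (R : realType) (n : nat).

Definition lebesgue_n : set (Rn R n) -> \bar R := @lebesgue_outer R n.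

HB.instance Definition _ := isMeasure.Build _ _ _ lebesgue_n
  (@caratheodory_measure0 _ _ (@lebesgue_outer R n))
  (@caratheodory_measure_ge0 _ _ (@lebesgue_outer R n))
  (@caratheodory_measure_sigma_additive _ _ (@lebesgue_outer R n)).

End lebesgue_n.

(* [`|x|] on row vectors is the max norm of the library. *)
Definition enorm (R : realType) (n : nat) (x : 'rV[R]_n) : R :=
  Num.sqrt (\sum_(i < n) x ord0 i ^+ 2).

(** * Domains *)

(* Near each boundary point and in suitable orthonormal coordinates, the domain
   is the strict epigraph of a Lipschitz function of the coordinates other than
   the [k]-th. *)
Definition C01_boundary (R : realType) (n : nat) (Omega : set 'rV[R]_n) : Prop :=
  forall x0, (closure Omega `\` Omega°) x0 ->
  exists (Q : 'M[R]_n) (k : 'I_n) (gamma : 'rV[R]_n.-1 -> R) (L : R),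
    [/\ Q *m Q^T = 1%:M, L.-lipschitz gamma &
      \forall x \near x0,
        Omega x <-> gamma (col' k (x *m Q)) < (x *m Q) ord0 k].

(* beta belongs to L^oo(R^n \ Omega); only its values there matter. *)
Definition Linfty_compl (R : realType) (n : nat) (Omega : set 'rV[R]_n)
    (beta : 'rV[R]_n -> R) : Prop :=
  measurable_fun (~` Omega : set (Rn R n)) (beta : Rn R n -> R) /\
  exists M : R,
    {ae @lebesgue_n R n, forall x, ~ Omega x -> `|beta x| <= M}.

(** * Young functions

    [G] and [g] are total functions of which only the values on [0, +oo[ are
    used. *)

(* As [g] is only right continuous, [g = G'] is read as: [g] is the right
   derivative of [G]. *)
Definition Young_function (R : realType) (G g : R -> R) : Prop :=
  [/\ forall t : R, 0 <= t ->
        (G t)%:E = (\int[lebesgue_measure]_(tau in `[0%R, t]) (g tau)%:E)%E,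
      forall t : R, 0 <= t -> g x @[x --> t^'+] --> g t,
      {in `[0, +oo[ &, {homo g : x y / x <= y}} &
      [/\ g 0 = 0, forall t : R, 0 < t -> 0 < g t,
          g x @[x --> +oo] --> +oo &
          forall t : R, 0 <= t ->
            h^-1 * (G (t + h) - G t) @[h --> (0 : R)^'+] --> g t]].

(* [1 < p^- <= t g(t) / G(t) <= p^+] for t > 0. *)
Definition growth_condition (R : realType) (pm pp : R) (G g : R -> R) : Prop :=
  1 < pm /\ forall t : R, 0 < t -> pm <= t * g t / G t <= pp.

(* The inverse of [G : [0, +oo[ -> [0, +oo[]. *)
Definition Ginv (R : realType) (G : R -> R) : R -> R :=
  'pinv_(fun=> 0) [set t | 0 <= t] G.

Definition integral_conditions (R : realType) (n : nat) (s : R) (G : R -> R) :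
    Prop :=
  ((\int[lebesgue_measure]_(tau in `]0%R, 1%R])
     (Ginv G tau / tau `^ ((n%:R + s) / n%:R))%:E < +oo) /\
   (\int[lebesgue_measure]_(tau in `[1%R, +oo[)
     (Ginv G tau / tau `^ ((n%:R + s) / n%:R))%:E = +oo))%E.

(** * Modulars, spaces and constrained minima *)

Section modulars.
Context (R : realType) (n : nat).
Variables (s : R) (G : R -> R) (Omega : set 'rV[R]_n) (beta : 'rV[R]_n -> R).
Implicit Types (u : 'rV[R]_n -> R) (E : set ('rV[R]_n * 'rV[R]_n)) (mu : R).

Definition Ds u (x y : 'rV[R]_n) : R := (u x - u y) / enorm (x - y) `^ s.

(* The integral of G(|D_s u|) dx dy / |x - y|^n over [E], with R^n x R^n seen as
   R^(n + n) with its Lebesgue measure. *)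
Definition Phi_s E u : \bar R :=
  (\int[@lebesgue_n R (n + n)]_(z in [set z | E (lsubmx z, rsubmx z)])
    (G `|Ds u (lsubmx z) (rsubmx z)|
       / enorm (lsubmx z - rsubmx z) ^+ n)%:E)%E.

Definition Phi_s_Rn u : \bar R := Phi_s setT u.
Definition Phi_s_Omega u : \bar R := Phi_s (Omega `*` Omega) u.
Definition Phi_s_star u : \bar R := Phi_s (~` (~` Omega `*` ~` Omega)) u.

Definition Phi_Rn u : \bar R := (\int[@lebesgue_n R n]_x (G `|u x|)%:E)%E.
Definition Phi_Omega u : \bar R :=
  (\int[@lebesgue_n R n]_(x in Omega) (G `|u x|)%:E)%E.
Definition Phi_beta u : \bar R :=
  (\int[@lebesgue_n R n]_(x in ~` Omega) (beta x * G `|u x|)%:E)%E.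

Definition W0 : set ('rV[R]_n -> R) :=
  [set u | measurable_fun [set: Rn R n] (u : Rn R n -> R) /\
    [/\ (Phi_Rn u < +oo)%E, (Phi_s_Rn u < +oo)%E &
        {ae @lebesgue_n R n, forall x, ~ Omega x -> u x = 0}]].

Definition Wstar : set ('rV[R]_n -> R) :=
  [set u | [/\ measurable_fun [set: Rn R n] (u : Rn R n -> R),
     (Phi_Omega u < +oo)%E & (Phi_s_star u < +oo)%E]].

(* Functions on [Omega], represented by arbitrary extensions to R^n; neither
   membership nor the modulars over [Omega] depend on the extension. *)
Definition Wreg : set ('rV[R]_n -> R) :=
  [set u | [/\ measurable_fun (Omega : set (Rn R n)) (u : Rn R n -> R),
     (Phi_Omega u < +oo)%E & (Phi_s_Omega u < +oo)%E]].

Definition Xspace : set ('rV[R]_n -> R) :=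
  [set u | Wstar u /\ (Phi_beta u < +oo)%E].

Definition Lambda_D mu : \bar R :=
  ereal_inf [set ((Phi_s_Rn u + Phi_Omega u) / Phi_Omega u)%E |
    u in W0 `&` [set u | Phi_Omega u = mu%:E]].

Definition Lambda_N mu : \bar R :=
  ereal_inf [set ((Phi_s_star u + Phi_Omega u) / Phi_Omega u)%E |
    u in Wstar `&` [set u | Phi_Omega u = mu%:E]].

Definition Lambda_Ntilde mu : \bar R :=
  ereal_inf [set ((Phi_s_Omega u + Phi_Omega u) / Phi_Omega u)%E |
    u in Wreg `&` [set u | Phi_Omega u = mu%:E]].

Definition Lambda_R mu : \bar R :=
  ereal_inf [set ((Phi_s_star u + Phi_Omega u + Phi_beta u) / Phi_Omega u)%E |
    u in Xspace `&` [set u | Phi_Omega u = mu%:E]].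

End modulars.

(* Main.v *)
Require Import Defs.
From HB Require Import structures.
From mathcomp Require Import all_boot all_order all_algebra.
From mathcomp Require Import all_classical all_reals all_analysis.

Set Implicit Arguments.
Unset Strict Implicit.
Unset Printing Implicit Defensive.

Import Order.TTheory GRing.Theory Num.Theory.
Import numFieldNormedType.Exports.

Local Open Scope classical_set_scope.
Local Open Scope ring_scope.

Import HBNNSimple.

(** The constant is [1]. Each of the four quotients has the form
    [(A + mu) / mu], where [mu = Phi_Omega u] and [A] is a sum of modulars,
    hence nonnegative; such a quotient is at least [1], and so is every infimum
    of such quotients (an infimum over the empty set being [+oo]).

    Nonnegativity of the modulars rests on [0 <= G], because [G] is an integral
    of the nonnegative function [g] ([Young_function_ge0]). It holds pointwise
    for the integrands of the fractional modulars, but only almost everywhere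
    for the integrand [beta G(|u|)] of the boundary term, as [beta] is positive
    only up to a null set. The boundary term is therefore handled by
    [ae_integral_ge0]. *)

(** A null set cannot make an integral negative: a nonnegative simple function
    below the negative part of [f] lives on the null set where [f < 0], so its
    integral vanishes. The argument stays at the level of simple functions
    because [D] and [f] may fail to be measurable, so that the integral of the
    negative part is only available as a supremum over them. *)
Lemma ae_integral_ge0 d (T : measurableType d) (R : realType)
    (mu : {measure set T -> \bar R}) (D : set T) (f : T -> \bar R) :
  {ae mu, forall x, D x -> (0 <= f x)%E} -> (0 <= \int[mu]_(x in D) f x)%E.
Proof.
move=> [N [mN N0 DN]].
rewrite integralE.
suff -> : (\int[mu]_(x in D) f^\- x = 0)%E by rewrite sube0 integral_ge0.
apply/eqP; rewrite eq_le integral_ge0 ?andbT//.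
rewrite ge0_integralE//; apply: ge_ereal_sup => _ [h /= hf <-].
rewrite sintegralEnnsfun fsbig1// => r /= r0.
rewrite (@subset_measure0 _ _ _ mu (h @^-1` [set r]) N) ?mule0//.
move=> x /= hx; apply: DN => /= f0.
have := hf x; rewrite hx patchE; case: ifPn => [/[!inE] Dx|_].
  rewrite funenegE max_r; first by rewrite lee_fin leNgt r0.
  by rewrite leeNl oppe0 f0.
by rewrite lee_fin leNgt r0.
Qed.

Lemma Young_function_ge0 (R : realType) (G g : R -> R) (t : R) :
  Young_function G g -> 0 <= t -> 0 <= G t.
Proof.
move=> [GE _ _ [g0 g_gt0 _ _]] t0; rewrite -lee_fin GE//.
apply: integral_ge0 => x /=; rewrite in_itv/= lee_fin => /andP[].
by rewrite le_eqVlt => /predU1P[<-|/g_gt0/ltW//]; rewrite g0.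
Qed.

Lemma Phi_s_ge0 (R : realType) (n : nat) (s : R) (G : R -> R)
    (E : set ('rV[R]_n * 'rV[R]_n)) (u : 'rV[R]_n -> R) :
  (forall t, 0 <= t -> 0 <= G t) -> (0 <= Phi_s s G E u)%E.
Proof.
move=> G_ge0; apply: integral_ge0 => z _.
by rewrite lee_fin divr_ge0 ?G_ge0// exprn_ge0// sqrtr_ge0.
Qed.

Lemma Phi_beta_ge0 (R : realType) (n : nat) (G : R -> R)
    (Omega : set 'rV[R]_n) (beta u : 'rV[R]_n -> R) :
  (forall t, 0 <= t -> 0 <= G t) ->
  {ae @lebesgue_n R n, forall x, ~ Omega x -> 0 < beta x} ->
  (0 <= Phi_beta G Omega beta u)%E.
Proof.
move=> G_ge0 [N [mN N0 betaN]]; apply: ae_integral_ge0.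
exists N; split => // x /= neg_x; apply: betaN => /= beta_gt0; apply: neg_x.
by move=> /beta_gt0/ltW beta_ge0; rewrite lee_fin mulr_ge0 ?G_ge0.
Qed.

Lemma le1_addediv (R : realType) (a : \bar R) (m : R) :
  (0 <= a)%E -> 0 < m -> (1 <= (a + m%:E) / m%:E)%E.
Proof.
move=> a0 m0; have -> : 1%E = (m%:E / m%:E)%E :> \bar R.
  by rewrite divee ?eqe ?gt_eqF.
by apply: lee_wpmul2r; [rewrite inve_ge0 lee_fin ltW|rewrite leeDr].
Qed.

Theorem proposition5p7 (R : realType) (n : nat) (s : R)
    (Omega : set 'rV[R]_n) (beta : 'rV[R]_n -> R) (G g : R -> R) (pm pp : R)
    (n_gt0 : (0 < n)%N) (s01 : 0 < s < 1)
    (Omega_open : open Omega) (Omega_bounded : bounded_set Omega)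
    (Omega_C01 : C01_boundary Omega)
    (beta_Linfty : Linfty_compl Omega beta)
    (beta_gt0 : {ae @lebesgue_n R n, forall x, ~ Omega x -> 0 < beta x})
    (G_Young : Young_function G g)
    (G_growth : growth_condition pm pp G g)
    (G_sqrt_convex :
      convex_function (`[0, +oo[%classic : set R) (fun t => G (Num.sqrt t)))
    (G_integral : integral_conditions n s G) :
  exists c : R, 0 < c /\ forall mu : R, 0 < mu ->
    [/\ (c%:E <= Lambda_Ntilde s G Omega mu)%E,
        (c%:E <= Lambda_N s G Omega mu)%E,
        (c%:E <= Lambda_R s G Omega beta mu)%E &
        (c%:E <= Lambda_D s G Omega mu)%E].
Proof.
have G_ge0 t := @Young_function_ge0 R G g t G_Young.
exists 1; split => // mu mu0; split; apply: le_ereal_inf_tmp => _ [u [_ /= ->] <-].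
- by apply: le1_addediv => //; exact: Phi_s_ge0.
- by apply: le1_addediv => //; exact: Phi_s_ge0.
- rewrite addeAC; apply: le1_addediv => //.
  by apply: adde_ge0; [exact: Phi_s_ge0|exact: Phi_beta_ge0].
- by apply: le1_addediv => //; exact: Phi_s_ge0.
Qed.
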